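(* Let $a>0$ and let $q\in L^2(0,a)$ be real-valued and even ($q(x)=q(a-x)$). Consider the periodic Schrödinger operator $H=-\frac{d^2}{dx^2}+q$, with continuity–Kirchhoff (Neumann) vertex conditions, on the metric graph $G$ of each of the Archimedean tilings listed below, with the same potential $q$ on every edge. Write $S=S(a,\rho)$, $S'=S'(a,\rho)$, $\lambda=\rho^2$, and let $\theta_1,\theta_2\in[-\pi,\pi]$. Then the dispersion relation (the equation in $(\rho,\theta_1,\theta_2)$ whose solution set is the set of $(\lambda,\Theta)$ with $\lambda$ an eigenvalue of the Bloch Hamiltonian $H^{\Theta}$, $\Theta=(\theta_1,\theta_2)$) is as follows. (a) For the truncated hexagonal tiling $(3,12^2)$ (operator $H_{trH}$): $$3S^3S'(3S'+2)\left\{81(S')^4-54(S')^3-45(S')^2+18S'-8\cos\tfrac{\theta_1}{2}\cos\tfrac{\theta_2}{2}\cos\tfrac{\theta_1-\theta_2}{2}+8\right\}=0.$$ (b) For the snub square tiling $(3^2,4,3,4)$ (operator $H_{SS}$), with $c=\cos\theta_1$, $d=\cos\theta_2$: $$S^6\left\{625(S')^4-250(S')^2-40S'+1-100(c+d)(S')^2-40(c+d+cd)S'-4(c+d+4cd-c^2-d^2)\right\}=0.$$ (c) For the rhombi-trihexagonal tiling $(3,4,6,4)$ (operator $H_{RTH}$): $$S^6\Big\{2048(S')^6-1536(S')^4-128(S')^3+192(S')^2-3-2(64(S')^3+32(S')^2-1)(\cos\theta_1+\cos(\theta_1+\theta_2)+\cos\theta_2)$$ $$+(\cos2(\theta_1+\theta_2)+\cos2\theta_1+\cos2\theta_2)-2(\cos(2\theta_1+\theta_2)+\cos(\theta_1-\theta_2)+\cos(\theta_1+2\theta_2))\Big\}=0.$$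 (d) For the snub trihexagonal tiling $(3^4,6)$ (operator $H_{STH}$): $$S^9\Big\{15625(S')^6-9375(S')^4-2000(S')^3+675(S')^2+120S'-11+2(\cos2\theta_1+\cos2\theta_2+\cos2(\theta_1+\theta_2))$$ $$-4(\cos(2\theta_1+\theta_2)+\cos(\theta_1+2\theta_2)+\cos(\theta_2-\theta_1))(2+5S')$$ $$-4(\cos\theta_1+\cos\theta_2+\cos(\theta_1+\theta_2))(250(S')^3+150(S')^2+15S'-2)\Big\}=0.$$ (e) For the truncated trihexagonal tiling $(4,6,12)$ (operator $H_{trTH}$): $$S^6\Big\{531441(S')^{12}-1062882(S')^{10}+728271(S')^8-204120(S')^6+21627(S')^4-918(S')^2+15$$ $$+2(\cos2\theta_1+\cos2\theta_2+\cos2(\theta_1-\theta_2))+4(\cos(2\theta_1-\theta_2)+\cos(\theta_1+\theta_2)+\cos(\theta_1-2\theta_2))(1-18(S')^2)$$ $$+4(\cos\theta_1+\cos(\theta_1-\theta_2)+\cos\theta_2)(-2187(S')^6+1215(S')^4-135(S')^2+4)\Big\}=0.$$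
   Context: Each tiling is viewed as an infinite metric graph $G$ in the plane whose edges are the sides of the regular polygons, all of length $a$. Vertex configurations: truncated hexagonal $(3,12,12)$ (a triangle and two dodecagons at each vertex); snub square $(3,3,4,3,4)$; rhombi-trihexagonal $(3,4,6,4)$; snub trihexagonal $(3,3,3,3,6)$; truncated trihexagonal $(4,6,12)$. The tilings are positioned so that their translation lattices are generated by $\vec k_1,\vec k_2$ as follows: truncated hexagonal $\vec k_1=((2+\sqrt3)a,0)$, $\vec k_2=((1+\frac{\sqrt3}{2})a,(\frac32+\sqrt3)a)$; snub square $\vec k_1=(\frac{\sqrt3+1}{2}a,\frac{\sqrt3+1}{2}a)$, $\vec k_2=(\frac{\sqrt3+1}{2}a,-\frac{\sqrt3+1}{2}a)$; rhombi-trihexagonal $\vec k_1=(\frac{\sqrt3+1}{2}a,\frac{\sqrt3+3}{2}a)$, $\vec k_2=(\frac{\sqrt3+1}{2}a,-\frac{\sqrt3+3}{2}a)$; snub trihexagonal $\vec k_1=(2a,\sqrt3 a)$, $\vec k_2=(\frac{5a}{2},-\frac{\sqrt3 a}{2})$; truncated trihexagonal $\vec k_1=(\frac{3+3\sqrt3}{2}a,\frac{3+\sqrt3}{2}a)$, $\vec k_2=(\frac{3+3\sqrt3}{2}a,-\frac{3+\sqrt3}{2}a)$. Each edge is identified with $[0,a]$. The operator $H$ acts by $y_e\mapsto -y_e''+q y_e$ on each edge $e$, with domain the functions $\mathbf y=(y_e)$ with $y_e\in H^2(e)$, $\sum_e\|y_e\|^2_{H^2(e)}<\infty$, continuous at each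 vertex and with the sum of outgoing derivatives at each vertex equal to zero; $H$ is self-adjoint. For $\Theta=(\theta_1,\theta_2)\in[-\pi,\pi]^2$, the Bloch Hamiltonian $H^\Theta$ is the same differential expression acting on admissible functions satisfying $\mathbf y(x+p_1\vec k_1+p_2\vec k_2)=e^{i(p_1\theta_1+p_2\theta_2)}\mathbf y(x)$ for all $(p_1,p_2)\in\mathbb Z^2$; it has discrete spectrum and $\sigma(H)=\bigcup_{\Theta\in[-\pi,\pi]^2}\sigma(H^\Theta)$. $C(x,\rho)$ and $S(x,\rho)$ denote the solutions of $-y''+qy=\rho^2y$ on $[0,a]$ with $C(0,\rho)=S'(0,\rho)=1$, $C'(0,\rho)=S(0,\rho)=0$ (prime is $d/dx$); for even $q$ one has $C(a,\rho)=S'(a,\rho)$.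
   Formalization: In (d) the second lattice vector is taken as −k₂ = (−5a/2, √3a/2), i.e. θ₂ is replaced by −θ₂: with the stated k₁, k₂ (at 60°) the formula with θ₁+θ₂ violates the tiling's sixfold symmetry and fails, e.g. at θ₁=θ₂=2π/3. *)

(* Defs.v *)
From Stdlib Require Import PArith.
From HB Require Import structures.
From mathcomp Require Import all_boot all_order all_algebra.
From mathcomp Require Import all_classical all_reals all_analysis.
From mathcomp Require Import complex.


Set Implicit Arguments.
Unset Strict Implicit.
Unset Printing Implicit Defensive.

Import Order.TTheory GRing.Theory Num.Theory.
Local Open Scope ring_scope.
Local Open Scope classical_set_scope.

(* Solutions of  -y'' + q y = lam y  on [0,a] with q in L^2(0,a).            *)
(* For q in L^2(0,a) (hence L^1), y in H^2(0,a) solves the equation iff y and *)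
(* y' are absolutely continuous with y'' = (q - lam) y a.e., i.e. iff there is *)
(* dy (= y') with the two integral identities below on [0,a].                *)
Definition is_sol (R : realType) (a : R) (q : R -> R) (lam : R)
  (y dy : R -> R) : Prop :=
  forall x : R, 0 <= x <= a ->
    [/\ (@lebesgue_measure R).-integrable `[0, x] (fun t => (dy t)%:E),
        (@lebesgue_measure R).-integrable `[0, x]
            (fun t => ((q t - lam) * y t)%:E),
        y x = y 0 + Rintegral (@lebesgue_measure R) `[0, x] dy
      & dy x = dy 0 + Rintegral (@lebesgue_measure R) `[0, x]
                        (fun t => (q t - lam) * y t)].

Definition cexpi (R : realType) (t : R) : R[i] := Complex (cos t) (sin t).

(* Periodic metric graphs, given by a fundamental domain.                    *)
(* Vertices of the fundamental cell are 0 .. pg_nv-1 (cell (0,0)).  Every   *)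
(* edge orbit under the translation lattice Z k1 + Z k2 has exactly one      *)
(* representative (u, v, p1, p2) in pg_edges: the edge joining vertex u of   *)
(* cell (0,0) to vertex v of cell (p1,p2), i.e. to the point                 *)
(* x_v + p1 k1 + p2 k2.  It is identified with [0,a], 0 being the u end.     *)
Record pgraph := PGraph { pg_nv : nat; pg_edges : seq (nat * nat * int * int) }.

Definition ed (u v : nat) (p1 p2 : int) : nat * nat * int * int :=
  (u, v, p1, p2).
Arguments ed u%_nat v%_nat p1%_Z p2%_Z.

Definition esrc (e : nat * nat * int * int) : nat := e.1.1.1.
Definition etgt (e : nat * nat * int * int) : nat := e.1.1.2.
Definition esh1 (e : nat * nat * int * int) : int := e.1.2.
Definition esh2 (e : nat * nat * int * int) : int := e.2.

Definition ephase (R : realType) (th1 th2 : R) (e : nat * nat * int * int) : R :=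
  (esh1 e)%:~R * th1 + (esh2 e)%:~R * th2.

(* lam is an eigenvalue of the Bloch Hamiltonian H^Theta, Theta = (th1,th2):
   there is a nonzero quasi-periodic  y  (y(x + p1 k1 + p2 k2) =
   e^{i(p1 th1 + p2 th2)} y(x)) in the domain of H with  -y''+qy = lam y  on
   every edge.  A quasi-periodic function is determined by its restrictions
   y_e = yr_e + i yi_e  to the edge representatives e; its translate to the
   edge e - (p1,p2) is  e^{-i(p1 th1+p2 th2)} y_e.  Continuity at the vertices
   (with common value phi w at vertex w of cell (0,0), hence
   e^{i(p.th)} phi w at vertex w of cell p) and the Kirchhoff condition (sum
   of outgoing derivatives = 0) at each vertex w of cell (0,0) are written out
   below. *)
Definition bloch_eigen (R : realType) (G : pgraph) (a : R) (q : R -> R)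
  (lam th1 th2 : R) : Prop :=
  let E := pg_edges G in
  let e_ i := nth (ed 0 0 0 0) E i in
  exists (yr yi dyr dyi : nat -> R -> R) (phi : nat -> R[i]),
    let Y i x := Complex (yr i x) (yi i x) in
    let DY i x := Complex (dyr i x) (dyi i x) in
    [/\ forall i : nat, (i < size E)%nat ->
          is_sol a q lam (yr i) (dyr i) /\ is_sol a q lam (yi i) (dyi i),
        forall i : nat, (i < size E)%nat ->
          Y i 0 = phi (esrc (e_ i)) /\
          Y i a = cexpi (ephase th1 th2 (e_ i)) * phi (etgt (e_ i)),
        forall w : nat, (w < pg_nv G)%nat ->
          \sum_(i < size E | esrc (e_ i) == w) DY i 0
          - \sum_(i < size E | etgt (e_ i) == w)
               cexpi (- ephase th1 th2 (e_ i)) * DY i a = 0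
      & exists (i : nat) (x : R), [/\ (i < size E)%nat, 0 <= x <= a & Y i x != 0]].

(* The five tilings (fundamental domains computed from the positions in the  *)
(* paper; coordinates in units of a).                          *)

(* Truncated hexagonal (3,12,12): k1 = (2+sqrt3, 0),
   k2 = (1+sqrt3/2, 3/2+sqrt3).  Dodecagons centred at the lattice points.
   Vertices: 0 (1.866,0.5) 1 (1.366,1.366) 2 (4.232,1.866) 3 (3.232,1.866)
             4 (2.366,1.366) 5 (3.732,2.732). *)
Definition trH_graph : pgraph := PGraph 6
  [:: ed 0 1 0 0; ed 0 4 0 0; ed 0 5 0 (-1); ed 1 2 (-1) 0; ed 1 4 0 0;
      ed 2 3 0 0; ed 2 5 0 0; ed 3 4 0 0; ed 3 5 0 0].

(* Snub square (3,3,4,3,4): k1 = ((sqrt3+1)/2)(1,1), k2 = ((sqrt3+1)/2)(1,-1).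
   Vertices: 0 (0.683,0.183) 1 (1.183,-0.683) 2 (2.049,-0.183)
             3 (1.549,0.683). *)
Definition SS_graph : pgraph := PGraph 4
  [:: ed 0 1 0 (-1); ed 0 1 0 0; ed 0 2 0 (-1); ed 0 3 (-1) 0; ed 0 3 0 0;
      ed 1 2 (-1) 0; ed 1 2 0 0; ed 1 3 (-1) 0; ed 2 3 0 0; ed 2 3 0 1].

(* Rhombi-trihexagonal (3,4,6,4): k1 = ((sqrt3+1)/2, (sqrt3+3)/2),
   k2 = ((sqrt3+1)/2, -(sqrt3+3)/2).  Hexagons centred at lattice points.
   Vertices: 0 (0.866,0.5) 1 (1.366,-1.366) 2 (1.866,0.5) 3 (1.866,-0.5)
             4 (1.366,1.366) 5 (0.866,-0.5). *)
Definition RTH_graph : pgraph := PGraph 6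
  [:: ed 0 1 0 (-1); ed 0 2 0 0; ed 0 4 0 0; ed 0 5 0 0; ed 1 2 (-1) 0; ed 1 3 0 0;
      ed 1 5 0 0; ed 2 3 0 0; ed 2 4 0 0; ed 3 4 0 1; ed 3 5 0 0; ed 4 5 1 0].

(* Snub trihexagonal (3,3,3,3,6): hexagons centred at the lattice points.
   Vertices: 0 (-1.5,0.866) 1 (0.5,0.866) 2 (-0.5,0.866) 3 (1,1.732)
             4 (-1,1.732) 5 (0,1.732). *)
Definition STH_graph : pgraph := PGraph 6
  [:: ed 0 1 0 1; ed 0 2 0 0; ed 0 3 (-1) 0; ed 0 4 0 0; ed 0 5 (-1) 0; ed 1 2 0 0;
      ed 1 3 0 0; ed 1 4 0 (-1); ed 1 5 0 0; ed 2 3 (-1) 0; ed 2 4 0 0; ed 2 5 0 0;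
      ed 3 4 0 (-1); ed 3 5 0 0; ed 4 5 0 0].

(* Truncated trihexagonal (4,6,12): k1 = ((3+3sqrt3)/2, (3+sqrt3)/2),
   k2 = ((3+3sqrt3)/2, -(3+sqrt3)/2).  Dodecagons centred at lattice points.
   Vertices: 0 (1.866,0.5) 1 (5.464,-1) 2 (4.598,-0.5) 3 (3.598,-0.5)
     4 (2.732,-1) 5 (6.330,0.5) 6 (6.330,-0.5) 7 (2.732,1) 8 (3.598,0.5)
     9 (4.598,0.5) 10 (5.464,1) 11 (1.866,-0.5). *)
Definition trTH_graph : pgraph := PGraph 12
  [:: ed 0 1 0 (-1); ed 0 7 0 0; ed 0 11 0 0; ed 1 2 0 0; ed 1 6 0 0; ed 2 3 0 0;
      ed 2 9 0 0; ed 3 4 0 0; ed 3 8 0 0; ed 4 5 (-1) 0; ed 4 11 0 0; ed 5 6 0 0;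
      ed 5 10 0 0; ed 6 7 0 1; ed 7 8 0 0; ed 8 9 0 0; ed 9 10 0 0;
      ed 10 11 1 0].

(* Large numeric constants: the image in a ring of a binary positive literal
   (avoids unary nat literals). E.g. pnum 531441 = 531441%:R. *)
Fixpoint pnum (R : nzRingType) (p : positive) : R :=
  match p with
  | xH => 1
  | xO p' => 2 * pnum R p'
  | xI p' => 1 + 2 * pnum R p'
  end.
Arguments pnum {R} p%_positive.

(* Main.v *)
Require Import Defs.
From Stdlib Require Import PArith ZArith.
From HB Require Import structures.
From mathcomp Require Import all_boot all_order all_algebra.
From mathcomp Require Import all_classical all_reals all_analysis.
From mathcomp Require Import measurable_realfun complex ssrZ ring lra.
Import Order.TTheory GRing.Theory Num.Theory.
Local Open Scope ring_scope.
Local Open Scope classical_set_scope.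

(** The Wronskian of two solutions is constant, and by evenness of [q] the
    reflection of a solution is a solution. Comparing an arbitrary solution [y]
    with [S(x)] and [S(a - x)] gives [y(a) = S' y(0) + S y'(0)] and
    [y(0) = S' y(a) - S y'(a)], where [S] and [S'] are taken at [a]. If
    [S <> 0], the outgoing derivatives are thus determined by the vertex values,
    and the Kirchhoff conditions say that [A(Theta) - deg * S'] kills the vector
    of vertex values, where [A(Theta)] is the adjacency matrix twisted by the
    quasi-momenta; [lam] is an eigenvalue iff the determinant vanishes. If
    [S = 0], multiples of the sine solution on the edges always combine to an
    eigenfunction since there are more edges than vertices. The determinants
    are Laurent polynomials in [S'], [e^{i th1}], [e^{i th2}], compared with the
    stated ones by computation. *)

Set Implicit Arguments.
Unset Strict Implicit.
Unset Printing Implicit Defensive.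

(** * Sturm-Liouville solutions on an edge *)

Section Analysis.
Context {R : realType}.
Notation mu := (@lebesgue_measure R).
Implicit Types (f g F P : R -> R) (a b c x z : R).

(** * Integrals over subintervals and increment estimates *)

Lemma Rintegral_split f a b c : a <= b -> b <= c ->
  mu.-integrable `[a, c] (EFin \o f) ->
  Rintegral mu `[a, c] f = Rintegral mu `[a, b] f + Rintegral mu `[b, c] f.
Proof.
move=> ab bc fi; rewrite addrC; apply/eqP; rewrite -subr_eq; apply/eqP.
rewrite Rintegral_itvB// ?bnd_simp//; apply: Rintegral_itv_obnd_cbnd.
by apply: integrableS fi => //; apply: subset_itvr; rewrite bnd_simp.
Qed.

Lemma integrable_subitv f a b c d : a <= c -> d <= b ->
  mu.-integrable `[a, b] (EFin \o f) -> mu.-integrable `[c, d] (EFin \o f).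
Proof.
move=> ac db; apply: integrableS => //.
by move=> t /=; rewrite !in_itv/= => /andP[ct td]; rewrite (le_trans ac ct) (le_trans td db).
Qed.

Lemma integrable_normr f a b : mu.-integrable `[a, b] (EFin \o f) ->
  mu.-integrable `[a, b] (EFin \o (fun t => `|f t|)).
Proof. by move=> fi; exact: (integrable_norm fi). Qed.

Lemma le_norm_Rintegral f g a b :
  mu.-integrable `[a, b] (EFin \o f) -> mu.-integrable `[a, b] (EFin \o g) ->
  (forall x, a <= x <= b -> `|f x| <= g x) ->
  `|Rintegral mu `[a, b] f| <= Rintegral mu `[a, b] g.
Proof.
move=> fi gi fg; apply: (le_trans (le_normr_Rintegral _ fi)) => //.
by apply: (le_Rintegral _ (integrable_normr fi) gi) => // x /=; rewrite in_itv/=; exact: fg.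
Qed.

Lemma Rintegral_cst_itv a b c : a <= b ->
  Rintegral mu `[a, b] (fun=> c) = c * (b - a).
Proof.
move=> ab; rewrite Rintegral_cst//= lebesgue_measure_itv/= lte_fin.
by move: ab; rewrite le_eqVlt => /predU1P[->|->]//=; rewrite ltxx subrr.
Qed.

Lemma integrable_cst_itv a b c : mu.-integrable `[a, b] (EFin \o fun=> c).
Proof.
have muoo : (mu `[a, b] < +oo)%E.
  by rewrite lebesgue_measure_itv/=; case: ifP => _; rewrite -?EFinB ltry.
by apply: (measurable_bounded_integrable _ muoo) => //; exact: bounded_cst.
Qed.

(** On a uniform subdivision into [n.+1] pieces each step costs [K * a / n.+1] times an increment of
    [P], and these increments telescope. *)
Lemma telescope_norm_le F P (K : R) a n (x := fun i : nat => a * i%:R / n.+1%:R) :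
  0 <= a ->
  (forall x z, 0 <= x -> x <= z -> z <= a ->
     `|F z - F x| <= K * (z - x) * (P z - P x)) ->
  `|F a - F 0| * n.+1%:R <= K * a * (P a - P 0).
Proof.
move=> a0 FP.
have n0 : (n.+1%:R : R) != 0 by rewrite pnatr_eq0.
have n0' : (0 : R) < n.+1%:R by rewrite ltr0n.
have step : forall m, (m <= n.+1)%N ->
    `|F (x m) - F (x 0%N)| <= K * a / n.+1%:R * (P (x m) - P (x 0%N)).
  elim=> [|m IH] mn; first by rewrite !subrr normr0 mulr0.
  have h : x m.+1 - x m = a / n.+1%:R by rewrite /x -natr1; field.
  have x0 : 0 <= x m by rewrite /x divr_ge0// mulr_ge0.
  have xx : x m <= x m.+1 by rewrite -subr_ge0 h divr_ge0// ltW.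
  have xa : x m.+1 <= a.
    by rewrite /x ler_pdivrMr// ler_wpM2l// ler_nat.
  have := FP _ _ x0 xx xa; rewrite h => H.
  have := IH (ltnW mn) => {}IH.
  apply: (le_trans (ler_distD (F (x m)) _ _)).
  apply: (le_trans (lerD H IH)).
  by rewrite le_eqVlt; apply/orP; left; apply/eqP; field.
have := step _ (leqnn _).
have -> : x n.+1 = a by rewrite /x; field.
have -> : x 0%N = 0 by rewrite /x mulr0 mul0r.
by rewrite -ler_pdivlMr// -mulrA -mulrA [_^-1 * _]mulrC !mulrA.
Qed.

(* The Wronskian satisfies this with [P] the primitive of [|q - lam|], which
   avoids a product rule for absolutely continuous functions. *)
Lemma quadratic_increments_cst F P (K : R) a : 0 <= a ->
  (forall x z, 0 <= x -> x <= z -> z <= a ->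
     `|F z - F x| <= K * (z - x) * (P z - P x)) ->
  F a = F 0.
Proof.
move=> a0 FP; apply/eqP; rewrite -subr_eq0 -normr_le0 leNgt; apply/negP => d0.
set d := `|F a - F 0| in d0.
(* By the Archimedean property the bound [K * a * (P a - P 0) / n.+1] falls below [d] for some
   [n]. *)
have [n hn] : exists n : nat, K * a * (P a - P 0) / d < n%:R.
  exists (Num.truncn (K * a * (P a - P 0) / d)).+1; exact: truncnS_gt.
have := @telescope_norm_le F P K a n a0 FP.
rewrite -/d leNgt => /negP; apply.
by rewrite [ltRHS]mulrC -ltr_pdivrMr//; apply: (lt_le_trans hn); rewrite ler_nat.
Qed.


Lemma Rintegral_lin f g a b (c d : R) :
  mu.-integrable `[a, b] (EFin \o f) -> mu.-integrable `[a, b] (EFin \o g) ->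
  mu.-integrable `[a, b] (EFin \o (fun t => c * f t + d * g t)) /\
  Rintegral mu `[a, b] (fun t => c * f t + d * g t)
    = c * Rintegral mu `[a, b] f + d * Rintegral mu `[a, b] g.
Proof.
move=> fi gi.
have cf : mu.-integrable `[a, b] (EFin \o (fun t => c * f t)).
  exact: (integrableZl _ c fi).
have dg : mu.-integrable `[a, b] (EFin \o (fun t => d * g t)).
  exact: (integrableZl _ d gi).
split; first exact: (integrableD _ cf dg).
by rewrite RintegralD// !RintegralZl.
Qed.

Lemma le_subitv_Rintegral f a b c d : a <= c -> c <= d -> d <= b ->
  mu.-integrable `[a, b] (EFin \o f) -> (forall x, 0 <= f x) ->
  Rintegral mu `[c, d] f <= Rintegral mu `[a, b] f.
Proof.
move=> ac cd db fi f0.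
rewrite (Rintegral_split ac (le_trans cd db) fi).
rewrite (Rintegral_split cd db); last exact: integrable_subitv fi.
have I0 u v : 0 <= Rintegral mu `[u, v] f by apply: Rintegral_ge0.
by rewrite addrCA lerDl addr_ge0.
Qed.

Lemma primitive_bound f (k a x : R) : 0 <= x -> x <= a ->
  mu.-integrable `[0, a] (EFin \o f) ->
  `|k + Rintegral mu `[0, x] f| <= `|k| + Rintegral mu `[0, a] (fun t => `|f t|).
Proof.
move=> x0 xa fi; apply: (le_trans (ler_normD _ _)); rewrite lerD2l.
have fx : mu.-integrable `[0, x] (EFin \o f) by apply: integrable_subitv fi.
apply: (le_trans (@le_norm_Rintegral f (fun t => `|f t|) _ _ fx _ _)) => //.
  exact: integrable_normr.
by apply: (le_subitv_Rintegral (lexx 0) x0 xa) => //; exact: integrable_normr.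
Qed.

(** * Constancy of the Wronskian *)

Section Solutions.
Variables (a : R) (q : R -> R) (lam : R).
Hypothesis a_ge0 : 0 <= a.
Hypothesis q_int : mu.-integrable `[0, a] (EFin \o q).
Let Q t := q t - lam.

Let Q_int : mu.-integrable `[0, a] (EFin \o Q).
Proof. exact: (integrableB _ q_int (integrable_cst_itv 0 a lam)). Qed.

Implicit Types y dy : R -> R.

Lemma sol_integrable y dy : is_sol a q lam y dy ->
  mu.-integrable `[0, a] (EFin \o dy) /\
  mu.-integrable `[0, a] (EFin \o (fun t => Q t * y t)).
Proof. by move=> /(_ a); rewrite a_ge0 lexx => /(_ isT)[]. Qed.

Lemma sol_increment y dy x z : is_sol a q lam y dy -> 0 <= x -> x <= z -> z <= a ->
  y z - y x = Rintegral mu `[x, z] dy /\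
  dy z - dy x = Rintegral mu `[x, z] (fun t => Q t * y t).
Proof.
move=> sy x0 xz za.
have /sy[_ _ -> ->] : 0 <= x <= a by rewrite x0 (le_trans xz).
have /sy[i1 i2 -> ->] : 0 <= z <= a by rewrite za (le_trans x0).
by rewrite (Rintegral_split x0 xz i1) (Rintegral_split x0 xz i2); split; ring.
Qed.

(** Both [y] and [dy] are a constant plus the primitive of an integrable function, so initial values
    and L^1 norms bound them on all of [0,a]. *)
Lemma sol_bounded y dy : is_sol a q lam y dy ->
  exists2 M, 0 <= M & forall x, 0 <= x <= a -> `|y x| <= M /\ `|dy x| <= M.
Proof.
move=> sy; have [i1 i2] := sol_integrable sy.
set M1 := `|y 0| + Rintegral mu `[0, a] (fun t => `|dy t|).
set M2 := `|dy 0| + Rintegral mu `[0, a] (fun t => `|Q t * y t|).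
have M10 : 0 <= M1 by rewrite addr_ge0//; exact: Rintegral_ge0.
have M20 : 0 <= M2 by rewrite addr_ge0//; exact: Rintegral_ge0.
exists (M1 + M2); first exact: addr_ge0.
move=> x xa; have [_ _ -> ->] := sy x xa; case/andP: xa => x0 xa; split.
  by apply: (le_trans (primitive_bound _ x0 xa i1)); rewrite lerDl.
by apply: (le_trans (primitive_bound _ x0 xa i2)); rewrite lerDr.
Qed.

(** [y] is Lipschitz because [dy] is bounded, while [dy] varies at most by [M] times the mass of
    [|q - lam|]. The right end [z] and the left end [x] are the points at which
    [wronskian_increment] freezes its factors. *)
Lemma sol_modulus y dy M x z t : is_sol a q lam y dy ->
  (forall x, 0 <= x <= a -> `|y x| <= M /\ `|dy x| <= M) -> 0 <= M ->
  0 <= x -> z <= a -> x <= t <= z ->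
  `|y t - y z| <= M * (z - x) /\
  `|dy t - dy x| <= M * Rintegral mu `[x, z] (fun t => `|Q t|).
Proof.
move=> sy yM M0 x0 za /andP[xt tz]; have [i1 i2] := sol_integrable sy.
have t0 := le_trans x0 xt; have ta := le_trans tz za.
split.
  rewrite distrC; have [-> _] := sol_increment sy t0 tz za.
  apply: (@le_trans _ _ (Rintegral mu `[t, z] (fun=> M))).
    apply: le_norm_Rintegral; [exact: integrable_subitv i1|exact: integrable_cst_itv|].
    move=> u /andP[tu uz]; apply: (yM u _).2.
    by rewrite (le_trans t0 tu) (le_trans uz za).
  by rewrite Rintegral_cst_itv// ler_wpM2l// lerB.
have [_ ->] := sol_increment sy x0 xt ta.
have Qa : mu.-integrable `[0, a] (EFin \o (fun t => `|Q t|)) by exact: integrable_normr.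
have Qt : mu.-integrable `[x, t] (EFin \o (fun t => `|Q t|)) by apply: integrable_subitv Qa.
have Qz : mu.-integrable `[x, z] (EFin \o (fun t => `|Q t|)) by apply: integrable_subitv Qa.
apply: (@le_trans _ _ (Rintegral mu `[x, t] (fun t => M * `|Q t|))).
  apply: le_norm_Rintegral.
  - exact: integrable_subitv i2.
  - exact: (integrableZl _ M Qt).
  - move=> u /andP[xu ut]; rewrite normrM mulrC ler_wpM2r//; apply: (yM u _).1.
    by rewrite (le_trans x0 xu) (le_trans ut ta).
by rewrite RintegralZl// ler_wpM2l// (le_subitv_Rintegral (lexx x) xt tz).
Qed.

(** Summation by parts splits the increment into the integrals of [Q t * (y x2 * z t - z x2 * y t)]
    and of [dz x1 * dy t - dy x1 * dz t]. The integrands vanish at [x2] and [x1] respectively, so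
    [sol_modulus] makes both integrals small of second order. *)
Lemma wronskian_increment y dy (z dz : R -> R) (M x1 x2 : R) :
  is_sol a q lam y dy -> is_sol a q lam z dz -> 0 <= M ->
  (forall x, 0 <= x <= a -> `|y x| <= M /\ `|dy x| <= M) ->
  (forall x, 0 <= x <= a -> `|z x| <= M /\ `|dz x| <= M) ->
  0 <= x1 -> x1 <= x2 -> x2 <= a ->
  `|(y x2 * dz x2 - dy x2 * z x2) - (y x1 * dz x1 - dy x1 * z x1)|
    <= 4 * M ^+ 2 * (x2 - x1) * Rintegral mu `[x1, x2] (fun t => `|Q t|).
Proof.
move=> sy sz M0 yM zM x10 x12 x2a.
have [y1 y2] := sol_integrable sy; have [z1 z2] := sol_integrable sz.
have sub f : mu.-integrable `[0, a] (EFin \o f) ->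
    mu.-integrable `[x1, x2] (EFin \o f) by exact: integrable_subitv.
have [I1 E1] := Rintegral_lin (y x2) (- z x2) (sub _ z2) (sub _ y2).
have [I2 E2] := Rintegral_lin (dz x1) (- dy x1) (sub _ y1) (sub _ z1).
have [yd dyd] := sol_increment sy x10 x12 x2a.
have [zd dzd] := sol_increment sz x10 x12 x2a.
rewrite -dyd -dzd in E1; rewrite -yd -zd in E2.
set P := Rintegral mu `[x1, x2] (fun t => `|Q t|).
have Qi : mu.-integrable `[x1, x2] (EFin \o (fun t => `|Q t|)).
  by apply: integrable_normr; exact: sub.
have inA t : x1 <= t <= x2 -> 0 <= t <= a.
  by move=> /andP[h1 h2]; rewrite (le_trans x10 h1) (le_trans h2 x2a).
have B1 : `|Rintegral mu `[x1, x2]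
     (fun t => y x2 * (Q t * z t) + - z x2 * (Q t * y t))| <=
     2 * M ^+ 2 * (x2 - x1) * P.
  rewrite -RintegralZl//; apply: le_norm_Rintegral => //.
    exact: (integrableZl _ _ Qi).
  move=> t tx; have [dyt _] := sol_modulus sy yM M0 x10 x2a tx.
  have [dzt _] := sol_modulus sz zM M0 x10 x2a tx.
  have [y2M _] : `|y x2| <= M /\ `|dy x2| <= M by apply/yM/inA; rewrite x12 lexx.
  have [z2M _] : `|z x2| <= M /\ `|dz x2| <= M by apply/zM/inA; rewrite x12 lexx.
  (* The products [y x2 * z x2] cancel, which brings in the differences bounded by [sol_modulus]. *)
  have -> : y x2 * (Q t * z t) + - z x2 * (Q t * y t) =
    (y x2 * (z t - z x2) - z x2 * (y t - y x2)) * Q t by ring.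
  rewrite normrM ler_wpM2r//; apply: (le_trans (ler_normB _ _)).
  rewrite !normrM.
  have -> : 2 * M ^+ 2 * (x2 - x1) = M * (M * (x2 - x1)) + M * (M * (x2 - x1)) by ring.
  by rewrite lerD// ler_pM.
have B2 : `|Rintegral mu `[x1, x2]
     (fun t => dz x1 * dy t + - dy x1 * dz t)| <=
     2 * M ^+ 2 * P * (x2 - x1).
  rewrite -Rintegral_cst_itv//; apply: le_norm_Rintegral => //.
    exact: integrable_cst_itv.
  move=> t tx; have [_ dyt] := sol_modulus sy yM M0 x10 x2a tx.
  have [_ dzt] := sol_modulus sz zM M0 x10 x2a tx.
  have [_ y2M] : `|y x1| <= M /\ `|dy x1| <= M by apply/yM/inA; rewrite x12 lexx.
  have [_ z2M] : `|z x1| <= M /\ `|dz x1| <= M by apply/zM/inA; rewrite x12 lexx.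
  have -> : dz x1 * dy t + - dy x1 * dz t =
    dz x1 * (dy t - dy x1) - dy x1 * (dz t - dz x1) by ring.
  apply: (le_trans (ler_normB _ _)); rewrite !normrM.
  have -> : 2 * M ^+ 2 * P = M * (M * P) + M * (M * P) by ring.
  by rewrite lerD// ler_pM.
rewrite E1 in B1; rewrite E2 in B2.
have -> : y x2 * dz x2 - dy x2 * z x2 - (y x1 * dz x1 - dy x1 * z x1) =
  (y x2 * (dz x2 - dz x1) + - z x2 * (dy x2 - dy x1)) +
  (dz x1 * (y x2 - y x1) + - dy x1 * (z x2 - z x1)) by ring.
apply: (le_trans (ler_normD _ _)); apply: (le_trans (lerD B1 B2)).
by rewrite le_eqVlt; apply/orP; left; apply/eqP; ring.
Qed.

Lemma wronskian_cst y dy (z dz : R -> R) x :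
  is_sol a q lam y dy -> is_sol a q lam z dz -> 0 <= x <= a ->
  y x * dz x - dy x * z x = y 0 * dz 0 - dy 0 * z 0.
Proof.
move=> sy sz /andP[x0 xa].
have [My My0 yM] := sol_bounded sy; have [Mz Mz0 zM] := sol_bounded sz.
pose M := My + Mz.
have M0 : 0 <= M by exact: addr_ge0.
have yM' t : 0 <= t <= a -> `|y t| <= M /\ `|dy t| <= M.
  by move=> /yM[h1 h2]; split; [apply: (le_trans h1)|apply: (le_trans h2)]; rewrite lerDl.
have zM' t : 0 <= t <= a -> `|z t| <= M /\ `|dz t| <= M.
  by move=> /zM[h1 h2]; split; [apply: (le_trans h1)|apply: (le_trans h2)]; rewrite lerDr.
apply: (@quadratic_increments_cst (fun x => y x * dz x - dy x * z x)
  (fun x => Rintegral mu `[0, x] (fun t => `|Q t|)) (4 * M ^+ 2)) => // x1 x2 x10 x12 x2x.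
have x2a := le_trans x2x xa.
have -> : Rintegral mu `[0, x2] (fun t => `|Q t|) - Rintegral mu `[0, x1] (fun t => `|Q t|)
   = Rintegral mu `[x1, x2] (fun t => `|Q t|).
  rewrite (Rintegral_split x10 x12); first by rewrite addrC addKr.
  by apply: integrable_normr; exact: integrable_subitv Q_int.
exact: wronskian_increment.
Qed.

End Solutions.

(** * Reflection of the interval *)

Lemma measurable_reflect a : measurable_fun [set: measurableTypeR R]
  ((fun t => a - t) : measurableTypeR R -> measurableTypeR R).
Proof. exact: measurable_funB. Qed.

(** Lebesgue measure is determined by its values on half-open intervals, and the preimage of []b,
    c]] is [[a - c, a - b[], of the same length. *)
Lemma lebesgue_measure_reflect a (A : set R) : measurable A ->
  pushforward mu ((fun t => a - t) : measurableTypeR R -> measurableTypeR R) A = mu A.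
Proof.
move=> mA.
have mphi := measurable_reflect a.
apply/esym/lebesgue_measure_unique => //= _ [[b c]] _ <-.
rewrite /pushforward/=.
have -> : (fun t => a - t) @^-1` `]b, c] = `[a - c, a - b[.
  by apply/seteqP; split => t /=; rewrite !in_itv/=; lra.
rewrite !lebesgue_measure_itv/= !lte_fin ltrD2l ltrN2 -!EFinB.
by case: ifP => // _; congr (_%:E); ring.
Qed.

Lemma Rintegral_reflect f a x : 0 <= x -> x <= a ->
  mu.-integrable `[0, a] (EFin \o f) ->
  mu.-integrable `[0, x] (EFin \o (fun t => f (a - t))) /\
  Rintegral mu `[0, x] (fun t => f (a - t)) = Rintegral mu `[a - x, a] f.
Proof.
move=> x0 xa fi.
pose D : set R := `[a - x, a].
pose phi := (fun t => a - t) : measurableTypeR R -> measurableTypeR R.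
have fD : mu.-integrable D (EFin \o f).
  by apply: integrable_subitv fi => //; rewrite subr_ge0.
have phiD : phi @^-1` D = `[0, x].
  by apply/seteqP; split => t; rewrite /D /phi /= !in_itv/=; lra.
(* Extension by zero outside [D] makes the integrand measurable on the whole line, as the
   pushforward formula requires. *)
pose g : measurableTypeR R -> \bar R := (EFin \o f) \_ D.
have mD : measurable D by exact: measurable_itv.
have mg : measurable_fun [set: measurableTypeR R] g.
  by have /(measurable_restrictT _ mD) := measurable_int mu fD.
have gf t : `[0, x] t -> g (phi t) = (f (a - t))%:E.
  rewrite -phiD => tD; rewrite /g patchE (_ : (phi t \in D) = true)//.
  exact/mem_set.
have mphi := measurable_reflect a.
have eqmu (h : measurableTypeR R -> \bar R) :
  (\int[pushforward mu phi]_(t in D) h t = \int[mu]_(t in D) h t)%E.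
  by apply: eq_measure_integral => A mA _; exact: lebesgue_measure_reflect.
have gi : mu.-integrable (phi @^-1` D) (g \o phi).
  apply/integrableP; split.
    by apply: measurable_funTS; exact: measurableT_comp.
  have := @ge0_integral_pushforward _ _ _ _ R phi mphi mu D (fun t => `|g t|%E) mD.
  rewrite /comp => <-; last 2 first.
    by apply: measurable_funTS; exact: measurableT_comp.
    by move=> t _; exact: abse_ge0.
  rewrite eqmu; have /integrableP[_] := fD; apply: le_lt_trans.
  rewrite le_eqVlt; apply/orP; left; apply/eqP/eq_integral => t tD.
  by rewrite /g patchE tD.
have := @integral_pushforward _ _ _ _ R phi mphi mu D g mg gi mD.
rewrite eqmu phiD => E.
split.
  rewrite phiD in gi; apply: eq_integrable gi => // t /set_mem tx.
  by rewrite /= gf.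
congr fine; transitivity (\int[mu]_(t in D) g t)%E.
  by rewrite E; apply: eq_integral => t /set_mem tx; rewrite /= gf.
by apply: eq_integral => t tD; rewrite /g patchE tD.
Qed.

(** On a bounded interval constants are integrable, and [|q x| <= 1 + q x ^+ 2]. *)
Lemma integrable_of_sqr (q : R -> R) a : measurable_fun `[0, a] q ->
  mu.-integrable `[0, a] (fun x => (q x ^+ 2)%:E) ->
  mu.-integrable `[0, a] (EFin \o q).
Proof.
move=> mq q2.
have i1 : mu.-integrable `[0, a] (EFin \o (fun x => 1 + q x ^+ 2)).
  exact: (integrableD _ (integrable_cst_itv 0 a 1) q2).
apply: (le_integrable _ _ _ i1) => //; first exact/measurable_EFinP.
move=> x _; rewrite /= lee_fin [leRHS]ger0_norm ?addr_ge0 ?sqr_ge0//.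
have := sqr_ge0 (`|q x| - 1); rewrite -(real_normK (num_real (q x))).
by have := normr_ge0 (q x); nra.
Qed.

(** * Endpoint values of solutions on an edge *)

Section Boundary.
Variables (a : R) (q : R -> R) (lam : R).
Hypothesis a_gt0 : 0 < a.
Hypothesis q_int : mu.-integrable `[0, a] (EFin \o q).
Hypothesis q_even : forall x, 0 <= x <= a -> q x = q (a - x).
Implicit Types y dy : R -> R.

(** Reflection reverses the sign of the derivative, and evenness of [q] turns the reflected equation
    into the original one. *)
Lemma sol_reflect y dy : is_sol a q lam y dy ->
  is_sol a q lam (fun x => y (a - x)) (fun x => - dy (a - x)).
Proof.
move=> sy x /andP[x0 xa]; have a0 := ltW a_gt0.
have [i1 i2] := sol_integrable a0 sy.
have [j1 e1] := Rintegral_reflect x0 xa i1.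
have [j2 e2] := Rintegral_reflect x0 xa i2.
have ax0 : 0 <= a - x by rewrite subr_ge0.
have axa : a - x <= a by rewrite gerBl.
have [h1 h2] := sol_increment sy ax0 axa (lexx a).
have N1 : (fun x => - dy (a - x)) = (fun x => -1 * dy (a - x)).
  by apply/funext => t; rewrite mulN1r.
have j1N : mu.-integrable `[0, x] (EFin \o (fun t => - dy (a - t))).
  by rewrite N1; exact: (integrableZl _ (-1) j1).
have ev t : 0 <= t <= x ->
    (q (a - t) - lam) * y (a - t) = (q t - lam) * y (a - t).
  by move=> /andP[t0 tx]; rewrite -q_even// t0 (le_trans tx xa).
split.
- exact: j1N.
- apply: eq_integrable j2 => // t /set_mem; rewrite /= in_itv/= => tx.
  by rewrite ev.
- rewrite subr0 N1.
  by rewrite RintegralZl// e1 -h1; ring.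
- rewrite subr0.
  have -> : Rintegral mu `[0, x] (fun t => (q t - lam) * y (a - t)) =
            Rintegral mu `[0, x] (fun t => (q (a - t) - lam) * y (a - t)).
    by apply: eq_Rintegral => t /set_mem; rewrite /= in_itv/= => tx; rewrite ev.
  by rewrite e2 -h2; ring.
Qed.

Lemma sol_lin (c d : R) y dy (z dz : R -> R) :
  is_sol a q lam y dy -> is_sol a q lam z dz ->
  is_sol a q lam (fun x => c * y x + d * z x) (fun x => c * dy x + d * dz x).
Proof.
move=> sy sz x xa; have [y1 y2 y3 y4] := sy x xa; have [z1 z2 z3 z4] := sz x xa.
have [j1 e1] := Rintegral_lin c d y1 z1.
have [j2 e2] := Rintegral_lin c d y2 z2.
have E : (fun t => (q t - lam) * (c * y t + d * z t)) =
    (fun t => c * ((q t - lam) * y t) + d * ((q t - lam) * z t)).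
  by apply/funext => t; ring.
split.
- exact: j1.
- by rewrite -E in j2; exact: j2.
- by rewrite e1 {1}y3 {1}z3; ring.
- by rewrite E e2 {1}y4 {1}z4; ring.
Qed.

Lemma sol_zero : is_sol a q lam (fun=> 0) (fun=> 0).
Proof.
move=> x _.
have E : (fun t : R => (q t - lam) * 0) = (fun=> 0) by apply/funext => t; rewrite mulr0.
have E0 : Rintegral mu `[0, x] (fun=> 0) = 0.
  by rewrite Rintegral_cst ?mul0r//; exact: measurable_itv.
split; rewrite ?E ?E0 ?addr0//; first exact: integrable_cst_itv.
rewrite (_ : (fun t => _) = EFin \o (fun t => (q t - lam) * 0))// E.
exact: integrable_cst_itv.
Qed.

Variables (s ds : R -> R).
Hypothesis s_sol : is_sol a q lam s ds.
Hypothesis s0 : s 0 = 0.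
Hypothesis ds0 : ds 0 = 1.

(** The Wronskian of [y] with the reflected solution [s (a - x)] is read off at both ends; at [a]
    the latter has value 0 and derivative -1. *)
Lemma sol_left_end y dy : is_sol a q lam y dy -> y a = ds a * y 0 + s a * dy 0.
Proof.
move=> sy; have aa : 0 <= a <= a by rewrite lexx ltW.
have := wronskian_cst (ltW a_gt0) q_int sy (sol_reflect s_sol) aa.
by rewrite !subrr subr0 s0 ds0 => H; lra.
Qed.

(** Here the Wronskian with [s] itself is compared at both ends. *)
Lemma sol_right_end y dy : is_sol a q lam y dy -> y 0 = ds a * y a - s a * dy a.
Proof.
move=> sy; have aa : 0 <= a <= a by rewrite lexx ltW.
have := wronskian_cst (ltW a_gt0) q_int sy s_sol aa.
by rewrite s0 ds0 => H; lra.
Qed.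

(** This replaces a uniqueness theorem: [y] has zero Cauchy data at 0, so its Wronskians with [s]
    and with the reflected [s] vanish, and these two solutions are independent because their own
    Wronskian is [- s a]. *)
Lemma sol_dirichlet_zero y dy x : s a != 0 -> is_sol a q lam y dy ->
  y 0 = 0 -> y a = 0 -> 0 <= x <= a -> y x = 0.
Proof.
move=> S0 sy y0 ya xa.
have dy0 : dy 0 = 0.
  have := sol_left_end sy; rewrite y0 ya mulr0 add0r => /esym/eqP.
  by rewrite mulf_eq0 (negPf S0) => /eqP.
have a0 := ltW a_gt0; have st := sol_reflect s_sol.
have W1 := wronskian_cst a0 q_int sy s_sol xa.
have W2 := wronskian_cst a0 q_int sy st xa.
have W3 := wronskian_cst a0 q_int s_sol st xa.
rewrite y0 dy0 in W1; rewrite y0 dy0 in W2; rewrite s0 ds0 subr0 in W3.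
apply/eqP; rewrite -(mulIr_eq0 _ (mulIf S0)); apply/eqP.
move: W1 W2 W3; set t := s (a - x); set dt := - ds (a - x) => W1 W2 W3.
have -> : s a = - (s x * dt - ds x * t) by rewrite W3; ring.
(* Eliminating [dy x] from the two vanishing Wronskians leaves [y x * s a]. *)
transitivity (t * (y x * ds x - dy x * s x) - s x * (y x * dt - dy x * t)); first by ring.
by rewrite W1 W2; ring.
Qed.

(** The functions [s (a - x) / s a] and [s x / s a] form an interpolation basis for the two endpoint
    values. *)
Lemma sol_interp (al be : R) : s a != 0 ->
  exists y dy, [/\ is_sol a q lam y dy, y 0 = al & y a = be].
Proof.
move=> S0; have st := sol_reflect s_sol.
exists (fun x => al / s a * s (a - x) + be / s a * s x).
exists (fun x => al / s a * - ds (a - x) + be / s a * ds x); split.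
- exact: (sol_lin (al / s a) (be / s a) st s_sol).
- by rewrite subr0 s0; field.
- by rewrite subrr s0; field.
Qed.

(** If [s] vanished on all of [0,a], the equation would keep [ds] equal to 1, whence
    [s a = a > 0]. *)
Lemma sol_sine_neq0 : exists2 x, 0 <= x <= a & s x != 0.
Proof.
apply: contrapT => H; have sz x : 0 <= x <= a -> s x = 0.
  by move=> xa; apply/eqP; apply: contrapT => /negP sx; apply: H; exists x.
have dsz x : 0 <= x <= a -> ds x = 1.
  move=> /andP[x0 xa]; have [_ _ _ ->] := s_sol (introT andP (conj x0 xa)).
  rewrite ds0; suff -> : Rintegral mu `[0, x] (fun t => (q t - lam) * s t) = 0.
    by rewrite addr0.
  rewrite -[RHS](mul0r (x - 0)) -Rintegral_cst_itv//.
  apply: eq_Rintegral => t /set_mem; rewrite /= in_itv/= => /andP[t0 tx].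
  by rewrite sz ?mulr0// t0 (le_trans tx).
have aa : 0 <= a <= a by rewrite lexx ltW.
have [_ _ + _] := s_sol aa.
rewrite sz// s0 (_ : Rintegral _ _ _ = 1 * (a - 0)).
  by move/eqP; rewrite subr0 mul1r add0r eq_sym gt_eqF.
rewrite -Rintegral_cst_itv ?ltW//.
by apply: eq_Rintegral => t /set_mem; rewrite /= in_itv/= => /dsz.
Qed.

End Boundary.
End Analysis.

(** * Reduction to a finite determinant *)

Section Graph.
Context {R : realType}.
Notation mu := (@lebesgue_measure R).

Lemma cexpiD (t u : R) : cexpi (t + u) = cexpi t * cexpi u.
Proof.
by apply/eqP; rewrite eq_complex /= cosD sinD; apply/andP; split; apply/eqP; ring.
Qed.

Lemma cexpi0 : cexpi (0 : R) = 1.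
Proof. by rewrite /cexpi cos0 sin0. Qed.

Lemma cexpiNK (t : R) : cexpi (- t) * cexpi t = 1.
Proof. by rewrite -cexpiD addNr cexpi0. Qed.

Lemma realC_lin (x y c d e f : R) :
  (x%:C)%C * Complex c d + (y%:C)%C * Complex e f
    = Complex (x * c + y * e) (x * d + y * f).
Proof.
by apply/eqP; rewrite eq_complex /=; apply/andP; split; apply/eqP; ring.
Qed.

Variables (G : pgraph) (th1 th2 : R).
Let E := pg_edges G.
Let n := pg_nv G.
Let e_ i := nth (ed 0 0 0 0) E i.

Definition edge_ok (nv : nat) (e : nat * nat * int * int) :=
  (esrc e < nv)%N && (etgt e < nv)%N.

Definition incident (w : nat) (e : nat * nat * int * int) :=
  (esrc e == w) || (etgt e == w).

Hypothesis G_ok : all (edge_ok n) E.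
Hypothesis G_cover : all (fun w => has (incident w) E) (iota 0 n).

Let src_lt i : (i < size E)%N -> (esrc (e_ i) < n)%N.
Proof. by move=> /(mem_nth (ed 0 0 0 0)) /(allP G_ok) /andP[]. Qed.

Let tgt_lt i : (i < size E)%N -> (etgt (e_ i) < n)%N.
Proof. by move=> /(mem_nth (ed 0 0 0 0)) /(allP G_ok) /andP[]. Qed.

(* Contribution of the edge [e] to the coefficient of [phi v] in
   [S a] times the Kirchhoff condition at [w]. *)
Definition edge_coef (x : R) (e : nat * nat * int * int) (v w : nat) : R[i] :=
  (esrc e == w)%:R * ((etgt e == v)%:R * cexpi (ephase th1 th2 e)
                      - (esrc e == v)%:R * (x%:C)%C)
  + (etgt e == w)%:R * ((esrc e == v)%:R * cexpi (- ephase th1 th2 e)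
                        - (etgt e == v)%:R * (x%:C)%C).

(** Column [w] holds the Kirchhoff condition at [w]; vertex values act as a row vector on the left,
    the side used by [det0P]. *)
Definition kirchhoff_mx (x : R) : 'M[R[i]]_n :=
  \matrix_(v, w) \sum_(e <- E) edge_coef x e v w.

Lemma sum_delta (m : nat) (f : 'I_m -> R[i]) (k : 'I_m) :
  \sum_(v < m) f v * (k == v :> nat)%:R = f k.
Proof.
rewrite (bigD1 k)//= eqxx mulr1 big1 ?addr0// => j jk.
by rewrite eq_sym (negPf (jk : val j != val k)) mulr0.
Qed.

Lemma row_mul_kirchhoff (x : R) (phi : nat -> R[i]) (v : 'rV[R[i]]_n) (w : 'I_n) :
  (forall u : 'I_n, v 0 u = phi u) ->
  (v *m kirchhoff_mx x) 0 w =
    \sum_(i < size E | esrc (e_ i) == w)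
       (cexpi (ephase th1 th2 (e_ i)) * phi (etgt (e_ i)) - (x%:C)%C * phi (esrc (e_ i)))
  + \sum_(i < size E | etgt (e_ i) == w)
       (cexpi (- ephase th1 th2 (e_ i)) * phi (esrc (e_ i)) - (x%:C)%C * phi (etgt (e_ i))).
Proof.
move=> vphi; rewrite mxE.
under eq_bigr => u _ do rewrite mxE (big_nth (ed 0 0 0 0)) big_mkord mulr_sumr.
rewrite exchange_big /= [X in _ = X + _]big_mkcond [X in _ = _ + X]big_mkcond -big_split /=.
apply: eq_bigr => i _; rewrite -/E -/(e_ i).
pose es := Ordinal (src_lt (ltn_ord i)); pose et := Ordinal (tgt_lt (ltn_ord i)).
set z := cexpi (ephase _ _ _); set z' := cexpi (- _).
(* The sums over [u] isolate the two endpoints of the edge and are then collapsed by [sum_delta]. *)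
transitivity ((esrc (e_ i) == w)%:R *
  (z * (\sum_(u < n) v 0 u * (et == u :> nat)%:R)
    - (x%:C)%C * (\sum_(u < n) v 0 u * (es == u :> nat)%:R))
 + (etgt (e_ i) == w)%:R *
  (z' * (\sum_(u < n) v 0 u * (es == u :> nat)%:R)
    - (x%:C)%C * (\sum_(u < n) v 0 u * (et == u :> nat)%:R))).
  rewrite !mulr_sumr -!sumrB !mulr_sumr -big_split; apply: eq_bigr => u _ /=.
  by rewrite /edge_coef -/z -/z'; ring.
rewrite !sum_delta !vphi /=.
by case: ifP => _; case: ifP => _; rewrite ?mul1r ?mul0r.
Qed.

Variables (a : R) (q : R -> R) (lam : R).
Hypothesis a_gt0 : 0 < a.
Hypothesis q_int : mu.-integrable `[0, a] (EFin \o q).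
Hypothesis q_even : forall x, 0 <= x <= a -> q x = q (a - x).
Variables (s ds : R -> R).
Hypothesis s_sol : is_sol a q lam s ds.
Hypothesis s0 : s 0 = 0.
Hypothesis ds0 : ds 0 = 1.

Section Coupled.
Variables yr yi dyr dyi : nat -> R -> R.
Variable phi : nat -> R[i].
Let Y i x := Complex (yr i x) (yi i x).
Let DY i x := Complex (dyr i x) (dyi i x).
Hypothesis Y_sol : forall i : nat, (i < size E)%N ->
  is_sol a q lam (yr i) (dyr i) /\ is_sol a q lam (yi i) (dyi i).
Hypothesis Y_vertex : forall i : nat, (i < size E)%nat ->
  Y i 0 = phi (esrc (e_ i)) /\
  Y i a = cexpi (ephase th1 th2 (e_ i)) * phi (etgt (e_ i)).

(** Multiplication by [s a] clears denominators: [sol_left_end] and [sol_right_end] express S y'(0)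
    and - S y'(a) by endpoint values alone. At a target the inverse phase carries the condition back
    to cell (0,0). *)
Lemma kirchhoff_sum (w : nat) :
  ((s a)%:C)%C * (\sum_(i < size E | esrc (e_ i) == w) DY i 0
          - \sum_(i < size E | etgt (e_ i) == w)
               cexpi (- ephase th1 th2 (e_ i)) * DY i a) =
    \sum_(i < size E | esrc (e_ i) == w)
       (cexpi (ephase th1 th2 (e_ i)) * phi (etgt (e_ i)) - ((ds a)%:C)%C * phi (esrc (e_ i)))
  + \sum_(i < size E | etgt (e_ i) == w)
       (cexpi (- ephase th1 th2 (e_ i)) * phi (esrc (e_ i)) - ((ds a)%:C)%C * phi (etgt (e_ i))).
Proof.
rewrite mulrBr !mulr_sumr -sumrN; congr (_ + _); apply: eq_bigr => i _.
  have [Y0 Ya] := Y_vertex (ltn_ord i); have [yrs yis] := Y_sol (ltn_ord i).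
  rewrite -Y0 -Ya; apply/eqP; rewrite eq_sym subr_eq addrC realC_lin; apply/eqP.
  by rewrite /Y (sol_left_end a_gt0 q_int q_even s_sol s0 ds0 yrs)
    (sol_left_end a_gt0 q_int q_even s_sol s0 ds0 yis).
have [Y0 Ya] := Y_vertex (ltn_ord i); have [yrs yis] := Y_sol (ltn_ord i).
set z := cexpi (- _).
have -> : phi (etgt (e_ i)) = z * Y i a by rewrite Ya mulrA cexpiNK mul1r.
rewrite -Y0.
have -> : Y i 0 = ((ds a)%:C)%C * Y i a + ((- s a)%:C)%C * DY i a.
  rewrite realC_lin /Y (sol_right_end a_gt0 q_int s_sol s0 ds0 yrs)
    (sol_right_end a_gt0 q_int s_sol s0 ds0 yis).
  by congr Complex; ring.
by rewrite rmorphN; ring.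
Qed.

End Coupled.

(** An eigenfunction has a nonzero vector of vertex values, for otherwise [sol_dirichlet_zero] would
    kill it on every edge. Conversely a kernel vector is interpolated along the edges. *)
Lemma bloch_eigen_det : s a != 0 ->
  bloch_eigen G a q lam th1 th2 <-> \det (kirchhoff_mx (ds a)) = 0.
Proof.
move=> S0.
have SC0 : ((s a)%:C)%C != 0 :> R[i] by rewrite eq_complex /= negb_and S0.
split.
  move=> [yr [yi [dyr [dyi [phi [Ysol Yv K [i [x [iE xa Yx]]]]]]]]].
  apply/eqP/det0P; exists (\row_(u < n) phi u); last first.
    apply/rowP => w; rewrite (@row_mul_kirchhoff _ phi); last by move=> u; rewrite mxE.
    by rewrite -(kirchhoff_sum Ysol Yv) K ?ltn_ord// mulr0 mxE.
  apply/eqP => /rowP v0; have phi0 u : (u < n)%N -> phi u = 0.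
    by move=> un; have := v0 (Ordinal un); rewrite !mxE.
  have [Y0 Ya] := Yv i iE; have [yrs yis] := Ysol i iE.
  move: Y0 Ya; rewrite !phi0 ?src_lt ?tgt_lt// mulr0 => -[yr0 yi0] [yra yia].
  move/negP: Yx; apply.
  rewrite (sol_dirichlet_zero a_gt0 q_int q_even s_sol s0 ds0 S0 yrs)//.
  by rewrite (sol_dirichlet_zero a_gt0 q_int q_even s_sol s0 ds0 S0 yis).
move=> /eqP /det0P[v v0 vK].
(* Vertex numbers outside the cell receive the default value 0. *)
pose phi (u : nat) : R[i] := if insub u is Some i then v 0 i else 0.
have phiE (u : 'I_n) : v 0 u = phi u by rewrite /phi valK.
have ex (al be : R[i]) : exists p : (R -> R) * (R -> R) * (R -> R) * (R -> R),
  [/\ is_sol a q lam p.1.1.1 p.1.1.2, is_sol a q lam p.1.2 p.2,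
      Complex (p.1.1.1 0) (p.1.2 0) = al & Complex (p.1.1.1 a) (p.1.2 a) = be].
  case: al be => [ar ai] [br bi].
  have [y [dy [ys y0 ya]]] := sol_interp a_gt0 q_even s_sol s0 ar br S0.
  have [z [dz [zs z0 za]]] := sol_interp a_gt0 q_even s_sol s0 ai bi S0.
  by exists (y, dy, z, dz); split => //=; rewrite ?y0 ?ya ?z0 ?za.
have /choice[p Hp] : forall i : nat, exists p : (R -> R) * (R -> R) * (R -> R) * (R -> R),
  [/\ is_sol a q lam p.1.1.1 p.1.1.2, is_sol a q lam p.1.2 p.2,
      Complex (p.1.1.1 0) (p.1.2 0) = phi (esrc (e_ i)) &
      Complex (p.1.1.1 a) (p.1.2 a) = cexpi (ephase th1 th2 (e_ i)) * phi (etgt (e_ i))].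
  by move=> i; exact: ex.
have Psol (i : nat) : (i < size E)%N -> is_sol a q lam (p i).1.1.1 (p i).1.1.2 /\
   is_sol a q lam (p i).1.2 (p i).2 by have [] := Hp i.
have Pv (i : nat) : (i < size E)%N ->
   Complex ((p i).1.1.1 0) ((p i).1.2 0) = phi (esrc (e_ i)) /\
   Complex ((p i).1.1.1 a) ((p i).1.2 a) =
     cexpi (ephase th1 th2 (e_ i)) * phi (etgt (e_ i)) by have [] := Hp i.
exists (fun i => (p i).1.1.1), (fun i => (p i).1.2),
  (fun i => (p i).1.1.2), (fun i => (p i).2), phi; split.
- exact: Psol.
- exact: Pv.
- move=> w wn; apply: (mulfI SC0); rewrite mulr0.
  have := kirchhoff_sum Psol Pv w => ->.
  have := row_mul_kirchhoff (ds a) (Ordinal wn) phiE => /= <-.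
  by rewrite vK mxE.
- have [u vu] : exists u, v 0 u != 0.
    by move/rV0Pn: v0.
  (* Every vertex meets an edge, so the nonzero value appears at an endpoint: at 0 if [u] is the
     source, at [a] up to an invertible phase if it is the target. *)
  have /hasP[e eE eu] : has (incident u) E.
    by apply: (allP G_cover); rewrite mem_iota add0n ltn_ord.
  have [i iE ei] := nthP (ed 0 0 0 0) eE.
  have [Y0 Ya] := Pv i iE.
  move: eu; rewrite -ei -/(e_ i) /incident => /orP[]/eqP eu.
    by exists i, 0; split => //; rewrite ?lexx ?ltW// Y0 eu -phiE.
  exists i, a; split => //; rewrite ?lexx ?ltW// Ya eu -phiE mulf_neq0//.
  apply/eqP => z0; have /eqP := cexpiNK (ephase th1 th2 (e_ i)).
  by rewrite z0 mulr0 eq_sym oner_eq0.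
Qed.

(* When [S(a) = 0], multiples of [S] on each edge vanish at all vertices, and
   there are fewer Kirchhoff conditions than edges. *)
Lemma bloch_eigen_dirichlet : (n < size E)%N -> s a = 0 ->
  bloch_eigen G a q lam th1 th2.
Proof.
move=> nE S0.
(* A row vector [c] times [B] lists the Kirchhoff sums of the function equal to [c 0 i] times [s] on
   edge [i], since [ds 0 = 1]. *)
pose B : 'M[R[i]]_(size E, n) := \matrix_(i, w)
  ((esrc (e_ i) == w)%:R
   - (etgt (e_ i) == w)%:R * (cexpi (- ephase th1 th2 (e_ i)) * ((ds a)%:C)%C)).
have : kermx B != 0.
  rewrite -mxrank_eq0 mxrank_ker subn_eq0 -ltnNge.
  exact: leq_ltn_trans (rank_leq_col B) nE.
case/rowV0Pn => c /sub_kermxP cB c0.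
pose cc (i : nat) : R[i] := if insub i is Some j then c 0 j else 0.
have ccE (i : 'I_(size E)) : c 0 i = cc i by rewrite /cc valK.
have sol_c k := sol_lin k 0 s_sol (@sol_zero R a q lam).
(* The summand [0 * 0] is the shape in which [sol_lin] and [sol_zero] yield a scalar multiple of
   [s]. *)
exists (fun i x => complex.Re (cc i) * s x + 0 * 0), (fun i x => complex.Im (cc i) * s x + 0 * 0),
  (fun i x => complex.Re (cc i) * ds x + 0 * 0), (fun i x => complex.Im (cc i) * ds x + 0 * 0),
  (fun=> 0).
split.
- by move=> i _; split; exact: sol_c.
- by move=> i _; rewrite s0 S0 !mulr0 !addr0.
- move=> w wn; have /matrixP /(_ 0 (Ordinal wn)) := cB; rewrite !mxE => cBw.
  apply: etrans cBw.
  rewrite [X in X - _ = _]big_mkcond [X in _ - X = _]big_mkcond -sumrB.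
  apply: eq_bigr => i _; rewrite mxE ccE /= ds0 !mulr1 !mulr0 !addr0.
  have -> : Complex (complex.Re (cc i)) (complex.Im (cc i)) = cc i by case: (cc i).
  have -> : Complex (complex.Re (cc i) * ds a) (complex.Im (cc i) * ds a) = cc i * ((ds a)%:C)%C.
    by case: (cc i) => u v; apply/eqP; rewrite eq_complex /= !mulr0 subr0 add0r !eqxx.
  by rewrite -/(e_ i); do 2 case: ifP => _; rewrite /= ?mulr1n ?mulr0n; ring.
- have [j cj] : exists j, c 0 j != 0 by move/rV0Pn: c0.
  have [x xa sx] := sol_sine_neq0 a_gt0 s_sol s0 ds0.
  exists j, x; split => //; move: cj; rewrite ccE !eq_complex /= !mulr0 !addr0 !mulf_eq0.
  by rewrite (negPf sx) !orbF.
Qed.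

End Graph.

(** * Determinants over Laurent polynomials *)

(* The term [(c, k, p, q)] stands for [c x^k e^{i (p th1 + q th2)}]. *)
Definition lterm := (Z * nat * int * int)%type.
Definition lpoly := seq lterm.

(** Like monomials are merged and a cancelled coefficient is dropped, so that a vanishing sum
    reduces to the empty list, the form tested by [det_check]. *)
Fixpoint lins (t : lterm) (P : lpoly) : lpoly :=
  if P is u :: P' then
    let: (c, k, p, q) := t in let: (c', k', p', q') := u in
    if [&& k == k', p == p' & q == q'] then
      let d := Z.add c c' in if Z.eqb d Z0 then P' else (d, k, p, q) :: P'
    else u :: lins t P'
  else [:: t].

Definition ladd (P Q : lpoly) : lpoly := foldr lins Q P.

Definition tmul (t u : lterm) : lterm :=
  let: (c, k, p, q) := t in let: (c', k', p', q') := u in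
  (Z.mul c c', (k + k')%N, p + p', q + q').

Definition lmul (P Q : lpoly) : lpoly :=
  foldr (fun t => ladd (map (tmul t) Q)) [::] P.

Definition tconst (c : Z) : lterm := (c, 0%N, 0, 0).

Definition tconj (t : lterm) : lterm :=
  let: (c, k, p, q) := t in (c, k, - p, - q).

Definition del (T : Type) (j : nat) (r : seq T) := take j r ++ drop j.+1 r.

(** One term of the Laplace expansion along the first row. An empty entry is skipped together with
    its minor, which keeps the expansion of these sparse matrices tractable. *)
Definition ldet_step (D : seq (seq lpoly) -> lpoly) (M : seq (seq lpoly))
    (j : nat) (acc : lpoly) : lpoly :=
  if nth [::] (head [::] M) j is (_ :: _) as e then
    ladd (lmul (map (tmul (tconst (if odd j then Zneg xH else Zpos xH))) e)
               (D (map (del j) (behead M)))) acc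
  else acc.

Fixpoint ldet (n : nat) (M : seq (seq lpoly)) : lpoly :=
  if n is n'.+1 then foldr (ldet_step (ldet n') M) [::] (iota 0 n)
  else [:: tconst (Zpos xH)].

(** The symbolic counterpart of [edge_coef], with the indeterminate standing for S'. *)
Definition edge_terms (e : nat * nat * int * int) (v w : nat) : lpoly :=
  (if esrc e == w then
     (if etgt e == v then [:: (Zpos xH, 0%N, esh1 e, esh2 e)] else [::])
     ++ (if esrc e == v then [:: (Zneg xH, 1%N, 0, 0)] else [::])
   else [::]) ++
  (if etgt e == w then
     (if esrc e == v then [:: (Zpos xH, 0%N, - esh1 e, - esh2 e)] else [::])
     ++ (if etgt e == v then [:: (Zneg xH, 1%N, 0, 0)] else [::])
   else [::]).

Definition kirchhoff_rows (G : pgraph) : seq (seq lpoly) :=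
  mkseq (fun v => mkseq (fun w =>
    foldr (fun e => ladd (edge_terms e v w)) [::] (pg_edges G)) (pg_nv G)) (pg_nv G).

(* [L] lists the terms [c x^k cos (p th1 + q th2)] of a real trigonometric
   polynomial, whence the comparison of the determinant with [(L + conj L) / 2]. *)
Definition det_check (G : pgraph) (L : lpoly) : bool :=
  let D := ldet (pg_nv G) (kirchhoff_rows G) in
  nilp (ladd (map (tmul (tconst (Zneg (xO xH)))) D) (ladd (L ++ map tconj L) [::])).

(** * Soundness of the symbolic computation *)

Section Eval.
Context {R : realType}.
Variables (x th1 th2 : R).

Definition zeval (c : Z) : R :=
  match c with Z0 => 0 | Zpos p => pnum p | Zneg p => - pnum p end.

(** Factoring through [int_of_Z] lets [zevalD] and [zevalM] follow from morphism properties. *)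
Lemma zevalE c : zeval c = (int_of_Z c)%:~R.
Proof.
have pE p : pnum p = (Pos.to_nat p)%:R :> R.
  elim: p => [p IH|p IH|] //=; rewrite IH.
  - by rewrite Pos2Nat.inj_xI -natrM -[1]/(1%:R) -natrD.
  - by rewrite Pos2Nat.inj_xO -natrM.
case: c => [|p|p]; rewrite /zeval /int_of_Z ?pE ?mulr0z//.
by rewrite NegzE prednK ?mulrNz//; exact/ssrnat.ltP/Pos2Nat.is_pos.
Qed.

Lemma zevalD c d : zeval (Z.add c d) = zeval c + zeval d.
Proof. by rewrite !zevalE -intrD -rmorphD. Qed.

Lemma zevalM c d : zeval (Z.mul c d) = zeval c * zeval d.
Proof. by rewrite !zevalE -intrM -rmorphM. Qed.

Definition angle (p q : int) : R := p%:~R * th1 + q%:~R * th2.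

Lemma angleD p q p' q' : angle (p + p') (q + q') = angle p q + angle p' q'.
Proof. by rewrite /angle !intrD; ring. Qed.

Lemma angleN p q : angle (- p) (- q) = - angle p q.
Proof. by rewrite /angle !mulrNz; ring. Qed.

Definition teval (t : lterm) : R[i] :=
  let: (c, k, p, q) := t in ((zeval c * x ^+ k)%:C)%C * cexpi (angle p q).

Definition leval (P : lpoly) : R[i] := \sum_(t <- P) teval t.

Lemma leval0 : leval [::] = 0. Proof. by rewrite /leval big_nil. Qed.

Lemma leval_cons t P : leval (t :: P) = teval t + leval P.
Proof. by rewrite /leval big_cons. Qed.

Lemma leval_cat P Q : leval (P ++ Q) = leval P + leval Q.
Proof. by rewrite /leval big_cat. Qed.

Lemma leval_ins t P : leval (lins t P) = teval t + leval P.
Proof.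
elim: P => [|u P IH]; first by rewrite /= leval_cons.
case: t IH => [[[c k] p] q] IH; case: u => [[[c' k'] p'] q'] /=.
case: ifP => [/and3P[/eqP<- /eqP<- /eqP<-]|_]; last first.
  by rewrite !leval_cons IH addrCA.
rewrite leval_cons addrA.
have -> : teval (c, k, p, q) + teval (c', k, p, q) = teval (Z.add c c', k, p, q).
  by rewrite /= zevalD mulrDl rmorphD mulrDl.
case: ifP => [/Z.eqb_eq cc|_]; last by rewrite leval_cons.
by rewrite cc /= mul0r rmorph0 mul0r add0r.
Qed.

Lemma leval_add P Q : leval (ladd P Q) = leval P + leval Q.
Proof.
elim: P => [|t P IH] /=; first by rewrite leval0 add0r.
by rewrite leval_ins IH leval_cons addrA.
Qed.

Lemma teval_mul t u : teval (tmul t u) = teval t * teval u.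
Proof.
case: t u => [[[c k] p] q] [[[c' k'] p'] q'] /=.
by rewrite zevalM exprD angleD cexpiD !rmorphM /=; ring.
Qed.

Lemma leval_map_mul t P : leval (map (tmul t) P) = teval t * leval P.
Proof.
by rewrite /leval big_map mulr_sumr; apply: eq_bigr => u _; rewrite teval_mul.
Qed.

Lemma leval_mul P Q : leval (lmul P Q) = leval P * leval Q.
Proof.
elim: P => [|t P IH] /=; first by rewrite leval0 mul0r.
by rewrite leval_add IH leval_map_mul leval_cons mulrDl.
Qed.

Lemma teval_const c : teval (tconst c) = ((zeval c)%:C)%C.
Proof. by rewrite /= /angle !mul0r addr0 cexpi0 expr0 !mulr1. Qed.

(** [bump j] is the index shift in the minors of [cofactor], so this identifies [del] with deletion
    of a column. *)
Lemma nth_del (T : Type) (x0 : T) j k r : nth x0 (del j r) k = nth x0 r (bump j k).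
Proof.
rewrite /del nth_cat size_take /bump; case: (ltnP j (size r)) => jr.
  case: (ltnP k j) => kj; first by rewrite nth_take.
  by rewrite nth_drop addSn subnKC// add1n.
rewrite take_oversize//; case: (ltnP k (size r)) => kr.
  by rewrite leqNgt (leq_trans kr jr).
rewrite drop_oversize ?(leq_trans jr)// nth_nil nth_default//.
by apply: (leq_trans kr); rewrite leq_addl.
Qed.

Lemma nth_map_del j (M : seq (seq lpoly)) i :
  nth [::] (map (del j) M) i = del j (nth [::] M i).
Proof.
have [iM|Mi] := ltnP i (size M); first by rewrite (nth_map [::]).
by rewrite !nth_default// size_map.
Qed.

Lemma leval_det n (M : seq (seq lpoly)) :
  \det (\matrix_(i < n, j < n) leval (nth [::] (nth [::] M i) j)) = leval (ldet n M).
Proof.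
elim: n M => [|n IH] M.
  by rewrite det_mx00 /= leval_cons leval0 addr0 teval_const.
rewrite (expand_det_row _ ord0).
pose F j := leval (nth [::] (head [::] M) j) *
  ((-1) ^+ j * leval (ldet n (map (del j) (behead M)))).
transitivity (\sum_(j < n.+1) F j).
  apply: eq_bigr => j _; rewrite mxE nth0 /F; congr (_ * _).
  rewrite /cofactor add0n -IH; congr (_ * \det _).
  by apply/matrixP => i k; rewrite !mxE nth_map_del nth_del nth_behead.
rewrite -(big_mkord xpredT F) /index_iota subn0.
have -> : ldet n.+1 M = foldr (ldet_step (ldet n) M) [::] (iota 0 n.+1) by [].
elim: (iota 0 n.+1) => [|j js IHj]; first by rewrite big_nil leval0.
rewrite big_cons {}IHj [foldr _ _ _ in RHS]/= {2}/ldet_step /F.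
(* An empty entry evaluates to 0, so skipping it does not change the sum. *)
case: (nth _ _ j) => [|t e]; first by rewrite leval0 mul0r add0r.
rewrite leval_add leval_mul leval_map_mul teval_const; congr (_ + _).
by rewrite -signr_odd mulrCA mulrA; case: (odd j); rewrite /zeval ?rmorphN ?rmorph1.
Qed.

Lemma leval_edge_terms e v w :
  leval (edge_terms e v w) = edge_coef th1 th2 x e v w.
Proof.
have cx p q : teval (Zpos xH, 0%N, p, q) = cexpi (angle p q).
  by rewrite /= mul1r rmorph1 mul1r.
have rx : teval (Zneg xH, 1%N, 0, 0) = - (x%:C)%C.
  by rewrite /= /angle !mul0r addr0 cexpi0 mulN1r rmorphN mulr1.
have l1 t : leval [:: t] = teval t by rewrite leval_cons leval0 addr0.
rewrite /edge_terms /edge_coef !leval_cat; congr (_ + _); case: ifP => _;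
  rewrite ?mul0r ?leval0// mul1r leval_cat; congr (_ + _); case: ifP => _;
  by rewrite ?mul1r ?mul0r ?oppr0 ?leval0 ?l1 ?rx ?cx ?angleN.
Qed.

Lemma kirchhoff_rowsP (G : pgraph) :
  \det (kirchhoff_mx G th1 th2 x) = leval (ldet (pg_nv G) (kirchhoff_rows G)).
Proof.
rewrite -leval_det; congr (\det _); apply/matrixP => v w; rewrite !mxE.
rewrite !nth_mkseq//; elim: (pg_edges G) => [|e E IH] /=.
  by rewrite big_nil leval0.
by rewrite big_cons leval_add leval_edge_terms IH.
Qed.

Definition ceval (L : lpoly) : R :=
  \sum_(t <- L) (let: (c, k, p, q) := t in zeval c * x ^+ k * cos (angle p q)).

(** Conjugate exponentials add up to twice a cosine; the sine parts cancel. *)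
Lemma leval_conj L : leval (L ++ map tconj L) = ((2 * ceval L)%:C)%C.
Proof.
rewrite leval_cat; elim: L => [|t L IH].
  by rewrite /= leval0 /ceval big_nil mulr0 addr0.
rewrite /= !leval_cons addrACA IH /ceval big_cons mulrDr [RHS]rmorphD; congr (_ + _).
case: t => [[[c k] p] q]; rewrite /= angleN -mulrDr; apply/eqP.
rewrite eq_complex /= cosN sinN !mul0r subr0 addr0 subrr mulr0 eqxx andbT.
by apply/eqP; ring.
Qed.

(** The check shows that [L] plus its conjugate minus twice the determinant cancels formally;
    evaluation and division by 2 give the identity for all values of the variables. *)
Lemma det_checkP (G : pgraph) (L : lpoly) : det_check G L ->
  \det (kirchhoff_mx G th1 th2 x) = ((ceval L)%:C)%C.
Proof.
rewrite /det_check => /nilP /(congr1 leval).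
rewrite leval0 !leval_add leval_map_mul leval_conj leval0 addr0 -kirchhoff_rowsP teval_const.
rewrite /= mulr1 rmorphN mulNr rmorphM addrC => /eqP; rewrite subr_eq0 => /eqP H.
apply: (mulfI (_ : ((2 : R)%:C)%C != 0)); last by rewrite H.
by rewrite eq_complex /= pnatr_eq0.
Qed.

End Eval.


(** * The five dispersion relations *)

Delimit Scope Z_scope with bZ.
Definition term (c : Z) (k : nat) (p q : int) : lterm := (c, k, p, q).
Arguments term c%_bZ k%_N p%_Z q%_Z.

(** The factor [3 * x * (3 * x + 2)] is multiplied out, with the triple cosine product linearised as
    in [cos3_half]. *)
Definition trH_terms : lpoly :=
 [:: term 729 6 0 0; term (-729) 4 0 0; term (-108) 3 0 0; term 162 2 0 0;
   term 36 1 0 0;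
   term (-18) 2 1 0; term (-18) 2 0 1; term (-18) 2 1 (-1);
   term (-12) 1 1 0; term (-12) 1 0 1; term (-12) 1 1 (-1)].

Lemma trH_check : det_check trH_graph trH_terms.
Proof. by vm_compute. Qed.

(** Products and squares of cosines are linearised; the squares contribute 4 to the constant term
    5. *)
Definition SS_terms : lpoly :=
 [:: term 625 4 0 0; term (-250) 2 0 0; term (-40) 1 0 0; term 5 0 0 0;
   term (-100) 2 1 0; term (-100) 2 0 1; term (-40) 1 1 0; term (-40) 1 0 1;
   term (-20) 1 1 1; term (-20) 1 1 (-1); term (-4) 0 1 0; term (-4) 0 0 1;
   term (-8) 0 1 1; term (-8) 0 1 (-1); term 2 0 2 0; term 2 0 0 2].

Lemma SS_check : det_check SS_graph SS_terms.
Proof. by vm_compute. Qed.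

(* Twice the polynomial of part (c). *)
Definition RTH_terms : lpoly :=
 [:: term 4096 6 0 0; term (-3072) 4 0 0; term (-256) 3 0 0; term 384 2 0 0;
   term (-6) 0 0 0;
   term (-256) 3 1 0; term (-256) 3 1 1; term (-256) 3 0 1;
   term (-128) 2 1 0; term (-128) 2 1 1; term (-128) 2 0 1;
   term 4 0 1 0; term 4 0 1 1; term 4 0 0 1;
   term 2 0 2 2; term 2 0 2 0; term 2 0 0 2;
   term (-4) 0 2 1; term (-4) 0 1 (-1); term (-4) 0 1 2].

Lemma RTH_check : det_check RTH_graph RTH_terms.
Proof. by vm_compute. Qed.

Definition STH_terms : lpoly :=
 [:: term 15625 6 0 0; term (-9375) 4 0 0; term (-2000) 3 0 0; term 675 2 0 0;
   term 120 1 0 0; term (-11) 0 0 0;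
   term 2 0 2 0; term 2 0 0 2; term 2 0 2 2;
   term (-8) 0 2 1; term (-8) 0 1 2; term (-8) 0 (-1) 1;
   term (-20) 1 2 1; term (-20) 1 1 2; term (-20) 1 (-1) 1;
   term (-1000) 3 1 0; term (-1000) 3 0 1; term (-1000) 3 1 1;
   term (-600) 2 1 0; term (-600) 2 0 1; term (-600) 2 1 1;
   term (-60) 1 1 0; term (-60) 1 0 1; term (-60) 1 1 1;
   term 8 0 1 0; term 8 0 0 1; term 8 0 1 1].

Lemma STH_check : det_check STH_graph STH_terms.
Proof. by vm_compute. Qed.

Definition trTH_terms : lpoly :=
 [:: term 531441 12 0 0; term (-1062882) 10 0 0; term 728271 8 0 0;
   term (-204120) 6 0 0; term 21627 4 0 0; term (-918) 2 0 0; term 15 0 0 0;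
   term 2 0 2 0; term 2 0 0 2; term 2 0 2 (-2);
   term 4 0 2 (-1); term 4 0 1 1; term 4 0 1 (-2);
   term (-72) 2 2 (-1); term (-72) 2 1 1; term (-72) 2 1 (-2);
   term (-8748) 6 1 0; term (-8748) 6 1 (-1); term (-8748) 6 0 1;
   term 4860 4 1 0; term 4860 4 1 (-1); term 4860 4 0 1;
   term (-540) 2 1 0; term (-540) 2 1 (-1); term (-540) 2 0 1;
   term 16 0 1 0; term 16 0 1 (-1); term 16 0 0 1].

Lemma trTH_check : det_check trTH_graph trTH_terms.
Proof. by vm_compute. Qed.

Definition graph_ok (G : pgraph) : bool :=
  [&& all (edge_ok (pg_nv G)) (pg_edges G),
      all (fun w => has (incident w) (pg_edges G)) (iota 0 (pg_nv G)) &
      (pg_nv G < size (pg_edges G))%N].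

Section Dispersion.
Context {R : realType}.
Notation mu := (@lebesgue_measure R).
Variables (a : R) (q : R -> R) (lam : R).
Hypothesis a_gt0 : 0 < a.
Hypothesis q_int : mu.-integrable `[0, a] (EFin \o q).
Hypothesis q_even : forall x, 0 <= x <= a -> q x = q (a - x).
Variables (s ds : R -> R).
Hypothesis s_sol : is_sol a q lam s ds.
Hypothesis s0 : s 0 = 0.
Hypothesis ds0 : ds 0 = 1.
Variables (th1 th2 : R).

Lemma bloch_eigen_ceval (G : pgraph) (L : lpoly) : graph_ok G -> det_check G L ->
  bloch_eigen G a q lam th1 th2 <-> s a = 0 \/ ceval (ds a) th1 th2 L = 0.
Proof.
move=> /and3P[Gok Gc Gs] chk; have [S0|S0] := eqVneq (s a) 0.
  split => _; first by left.
  exact: (bloch_eigen_dirichlet th1 th2 a_gt0 s_sol s0 ds0 Gs S0).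
rewrite (bloch_eigen_det th1 th2 Gok Gc a_gt0 q_int q_even s_sol s0 ds0 S0).
(* The determinant is the image of a real number, so its vanishing is that of its real part. *)
rewrite (det_checkP _ _ _ chk); split => [/(congr1 (@complex.Re R))/= ->|]; first by right.
by case=> [/eqP|->]; [rewrite (negPf S0)|].
Qed.

(** Only the zero set matters, so the power of [s a] can be any positive one and [k] absorbs a
    normalisation. The exponents in the five relations are the numbers of edges minus vertices. *)
Lemma bloch_eigen_factor (G : pgraph) (L : lpoly) (n : nat) (k P : R) :
  graph_ok G -> det_check G L -> k != 0 -> ceval (ds a) th1 th2 L = k * P ->
  bloch_eigen G a q lam th1 th2 <-> s a ^+ n.+1 * P = 0.
Proof.
move=> Gok chk k0 LP; rewrite (bloch_eigen_ceval Gok chk) LP; split.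
  by case=> [->|/eqP]; rewrite ?exprS ?mul0r// mulf_eq0 (negPf k0) => /eqP ->; rewrite mulr0.
move/eqP; rewrite mulf_eq0 expf_eq0 /= => /orP[/eqP|/eqP ->]; first by left.
by right; rewrite mulr0.
Qed.

End Dispersion.

(** * Trigonometric form of the determinants *)

Section Trig.
Context {R : realType}.
Implicit Types (x u v : R).

Lemma mul_cos_cos u v : cos u * cos v = (cos (u + v) + cos (u - v)) / 2.
Proof. by rewrite cosD cosB; field. Qed.

Lemma cos_sqr u : cos u ^+ 2 = (cos (2 * u) + 1) / 2.
Proof. by rewrite expr2 mul_cos_cos subrr cos0 mulr_natl. Qed.

(** Two rounds of product-to-sum recombine the half angles into [u], [v] and [u - v]; the constant
    comes from the squared cosine. *)
Lemma cos3_half u v : 8 * cos (u / 2) * cos (v / 2) * cos ((u - v) / 2)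
  = 2 * (cos u + cos v + cos (u - v) + 1).
Proof.
transitivity (8 * (cos (u / 2) * cos (v / 2)) * cos ((u - v) / 2)).
  by rewrite !mulrA.
rewrite mul_cos_cos; have -> : u / 2 - v / 2 = (u - v) / 2 by field.
transitivity (4 * (cos (u / 2 + v / 2) * cos ((u - v) / 2)
                   + cos ((u - v) / 2) ^+ 2)); first by field.
rewrite mul_cos_cos cos_sqr.
have -> : u / 2 + v / 2 + (u - v) / 2 = u by field.
have -> : u / 2 + v / 2 - (u - v) / 2 = v by field.
have -> : 2 * ((u - v) / 2) = u - v by field.
by field.
Qed.

Variables (x th1 th2 : R).
Ltac expand L := rewrite /ceval /L !big_cons big_nil /term; cbn [zeval pnum].

Lemma angle00 : angle th1 th2 0 0 = 0. Proof. by rewrite /angle; ring. Qed.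
Lemma angle10 : angle th1 th2 1 0 = th1. Proof. by rewrite /angle; ring. Qed.
Lemma angle01 : angle th1 th2 0 1 = th2. Proof. by rewrite /angle; ring. Qed.
Lemma angle20 : angle th1 th2 2 0 = 2 * th1. Proof. by rewrite /angle; ring. Qed.
Lemma angle02 : angle th1 th2 0 2 = 2 * th2. Proof. by rewrite /angle; ring. Qed.
Lemma angle11 : angle th1 th2 1 1 = th1 + th2. Proof. by rewrite /angle; ring. Qed.
Lemma angle22 : angle th1 th2 2 2 = 2 * (th1 + th2). Proof. by rewrite /angle; ring. Qed.
Lemma angle21 : angle th1 th2 2 1 = 2 * th1 + th2. Proof. by rewrite /angle; ring. Qed.
Lemma angle12 : angle th1 th2 1 2 = th1 + 2 * th2. Proof. by rewrite /angle; ring. Qed.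
Lemma angle1N : angle th1 th2 1 (-1) = th1 - th2. Proof. by rewrite /angle; ring. Qed.
Lemma angleN1 : angle th1 th2 (-1) 1 = th2 - th1. Proof. by rewrite /angle; ring. Qed.
Lemma angle2N : angle th1 th2 2 (-1) = 2 * th1 - th2. Proof. by rewrite /angle; ring. Qed.
Lemma angle1NN : angle th1 th2 1 (-2) = th1 - 2 * th2. Proof. by rewrite /angle; ring. Qed.
Lemma angle2NN : angle th1 th2 2 (-2) = 2 * (th1 - th2). Proof. by rewrite /angle; ring. Qed.

Definition anglesE := (angle00, angle10, angle01, angle20, angle02, angle11,
  angle22, angle21, angle12, angle1N, angleN1, angle2N, angle1NN, angle2NN, cos0).

Lemma trH_ceval : ceval x th1 th2 trH_terms =
  1 * (3 * (x * ((3 * x + 2) *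
       (81 * x ^+ 4 - 54 * x ^+ 3 - 45 * x ^+ 2 + 18 * x
        - 8 * cos (th1 / 2) * cos (th2 / 2) * cos ((th1 - th2) / 2) + 8)))).
Proof. by rewrite cos3_half; expand trH_terms; rewrite !anglesE; ring. Qed.

Lemma SS_ceval : ceval x th1 th2 SS_terms =
  1 * (625 * x ^+ 4 - 250 * x ^+ 2 - 40 * x + 1
        - 100 * (cos th1 + cos th2) * x ^+ 2
        - 40 * (cos th1 + cos th2 + cos th1 * cos th2) * x
        - 4 * (cos th1 + cos th2 + 4 * cos th1 * cos th2
               - cos th1 ^+ 2 - cos th2 ^+ 2)).
Proof.
by expand SS_terms; rewrite !anglesE -[4 * cos th1 * _]mulrA !mul_cos_cos !cos_sqr; field.
Qed.

Lemma RTH_ceval : ceval x th1 th2 RTH_terms =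
  2 * ((pnum 2048) * x ^+ 6 - (pnum 1536) * x ^+ 4 - 128 * x ^+ 3 + 192 * x ^+ 2 - 3
        - 2 * (64 * x ^+ 3 + 32 * x ^+ 2 - 1)
            * (cos th1 + cos (th1 + th2) + cos th2)
        + (cos (2 * (th1 + th2)) + cos (2 * th1) + cos (2 * th2))
        - 2 * (cos (2 * th1 + th2) + cos (th1 - th2) + cos (th1 + 2 * th2))).
Proof. by expand RTH_terms; rewrite !anglesE; ring. Qed.

Lemma STH_ceval : ceval x th1 th2 STH_terms =
  1 * ((pnum 15625) * x ^+ 6 - (pnum 9375) * x ^+ 4 - (pnum 2000) * x ^+ 3 + 675 * x ^+ 2
        + 120 * x - 11
        + 2 * (cos (2 * th1) + cos (2 * th2) + cos (2 * (th1 + th2)))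
        - 4 * (cos (2 * th1 + th2) + cos (th1 + 2 * th2) + cos (th2 - th1))
            * (2 + 5 * x)
        - 4 * (cos th1 + cos th2 + cos (th1 + th2))
            * (250 * x ^+ 3 + 150 * x ^+ 2 + 15 * x - 2)).
Proof. by expand STH_terms; rewrite !anglesE; ring. Qed.

Lemma trTH_ceval : ceval x th1 th2 trTH_terms =
  1 * ((pnum 531441) * x ^+ 12 - (pnum 1062882) * x ^+ 10 + (pnum 728271) * x ^+ 8
        - (pnum 204120) * x ^+ 6 + (pnum 21627) * x ^+ 4 - 918 * x ^+ 2 + 15
        + 2 * (cos (2 * th1) + cos (2 * th2) + cos (2 * (th1 - th2)))
        + 4 * (cos (2 * th1 - th2) + cos (th1 + th2) + cos (th1 - 2 * th2))
            * (1 - 18 * x ^+ 2)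
        + 4 * (cos th1 + cos (th1 - th2) + cos th2)
            * (- (pnum 2187) * x ^+ 6 + (pnum 1215) * x ^+ 4 - 135 * x ^+ 2 + 4)).
Proof. by expand trTH_terms; rewrite !anglesE; ring. Qed.

End Trig.

Unset Implicit Arguments.
Set Strict Implicit.

Theorem theorem1p2 (R : realType) (a : R) (q : R -> R) :
  0 < a ->
  measurable_fun `[0, a] q ->
  (@lebesgue_measure R).-integrable `[0, a] (fun x => (q x ^+ 2)%:E) ->
  (forall x, 0 <= x <= a -> q x = q (a - x)) ->
  forall (lam : R) (s ds : R -> R),
  is_sol a q lam s ds -> s 0 = 0 -> ds 0 = 1 ->
  forall th1 th2 : R, - pi <= th1 <= pi -> - pi <= th2 <= pi ->
  let S := s a in
  let S' := ds a in
  [/\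
   (* (a) truncated hexagonal *)
   (bloch_eigen trH_graph a q lam th1 th2 <->
     3 * S ^+ 3 * S' * (3 * S' + 2) *
       (81 * S' ^+ 4 - 54 * S' ^+ 3 - 45 * S' ^+ 2 + 18 * S'
        - 8 * cos (th1 / 2) * cos (th2 / 2) * cos ((th1 - th2) / 2) + 8) = 0),
   (* (b) snub square *)
   (bloch_eigen SS_graph a q lam th1 th2 <->
     let c := cos th1 in let d := cos th2 in
     S ^+ 6 *
       (625 * S' ^+ 4 - 250 * S' ^+ 2 - 40 * S' + 1
        - 100 * (c + d) * S' ^+ 2 - 40 * (c + d + c * d) * S'
        - 4 * (c + d + 4 * c * d - c ^+ 2 - d ^+ 2)) = 0),
   (* (c) rhombi-trihexagonal *)
   (bloch_eigen RTH_graph a q lam th1 th2 <->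
     S ^+ 6 *
       ((pnum 2048) * S' ^+ 6 - (pnum 1536) * S' ^+ 4 - 128 * S' ^+ 3 + 192 * S' ^+ 2 - 3
        - 2 * (64 * S' ^+ 3 + 32 * S' ^+ 2 - 1)
            * (cos th1 + cos (th1 + th2) + cos th2)
        + (cos (2 * (th1 + th2)) + cos (2 * th1) + cos (2 * th2))
        - 2 * (cos (2 * th1 + th2) + cos (th1 - th2) + cos (th1 + 2 * th2)))
     = 0),
   (* (d) snub trihexagonal *)
   (bloch_eigen STH_graph a q lam th1 th2 <->
     S ^+ 9 *
       ((pnum 15625) * S' ^+ 6 - (pnum 9375) * S' ^+ 4 - (pnum 2000) * S' ^+ 3 + 675 * S' ^+ 2
        + 120 * S' - 11
        + 2 * (cos (2 * th1) + cos (2 * th2) + cos (2 * (th1 + th2)))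
        - 4 * (cos (2 * th1 + th2) + cos (th1 + 2 * th2) + cos (th2 - th1))
            * (2 + 5 * S')
        - 4 * (cos th1 + cos th2 + cos (th1 + th2))
            * (250 * S' ^+ 3 + 150 * S' ^+ 2 + 15 * S' - 2)) = 0)
  &
   (* (e) truncated trihexagonal *)
   (bloch_eigen trTH_graph a q lam th1 th2 <->
     S ^+ 6 *
       ((pnum 531441) * S' ^+ 12 - (pnum 1062882) * S' ^+ 10 + (pnum 728271) * S' ^+ 8
        - (pnum 204120) * S' ^+ 6 + (pnum 21627) * S' ^+ 4 - 918 * S' ^+ 2 + 15
        + 2 * (cos (2 * th1) + cos (2 * th2) + cos (2 * (th1 - th2)))
        + 4 * (cos (2 * th1 - th2) + cos (th1 + th2) + cos (th1 - 2 * th2))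
            * (1 - 18 * S' ^+ 2)
        + 4 * (cos th1 + cos (th1 - th2) + cos th2)
            * (- (pnum 2187) * S' ^+ 6 + (pnum 1215) * S' ^+ 4 - 135 * S' ^+ 2 + 4)) = 0)].
Proof.
move=> a_gt0 mq q2 q_even lam s ds s_sol s0 ds0 th1 th2 _ _ S S'.
have q_int := integrable_of_sqr mq q2.
have one_neq0 : (1 : R) != 0 := oner_neq0 R.
have two_neq0 : (2 : R) != 0 by rewrite pnatr_eq0.
have disp G L n k P : graph_ok G -> det_check G L -> k != 0 ->
    ceval S' th1 th2 L = k * P ->
    bloch_eigen G a q lam th1 th2 <-> S ^+ n.+1 * P = 0.
  exact: (bloch_eigen_factor a_gt0 q_int q_even s_sol s0 ds0).
split.
(* The power of [S] is moved to the front. The numeral passed to [disp] is one less than the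
   exponent of [S]. *)
- have E Q : 3 * S ^+ 3 * S' * (3 * S' + 2) * Q =
      S ^+ 3 * (3 * (S' * ((3 * S' + 2) * Q))) by ring.
  by rewrite E; exact: (disp _ _ 2%N _ _ _ trH_check one_neq0 (trH_ceval _ _ _)).
- exact: (disp _ _ 5%N _ _ _ SS_check one_neq0 (SS_ceval _ _ _)).
- exact: (disp _ _ 5%N _ _ _ RTH_check two_neq0 (RTH_ceval _ _ _)).
- exact: (disp _ _ 8%N _ _ _ STH_check one_neq0 (STH_ceval _ _ _)).
- exact: (disp _ _ 5%N _ _ _ trTH_check one_neq0 (trTH_ceval _ _ _)).
Qed.
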